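(* Let $p>1$, $N\in\mathbb{N}$, and let $\mu_1,\mu_2$ be permutation invariant Radon probability measures on $\mathbb{R}^N$ whose $p_0$:th moments are finite for some $p_0\ge p$. Let $J=(J_1,\dots,J_{n_J})$ be a finite sequence of elements of $[N]$ (repetitions allowed), of length $n_J$, and let $I=\{J_\ell:\ell\in[n_J]\}\subset[N]$. For $x\in\mathbb{R}^N$ put $x^J=\prod_{\ell=1}^{n_J}x_{J_\ell}$. Assume $n_J\le p_0+1-\frac{p_0}{p}$. Then \[ \left|\langle x^J\rangle_{\mu_1}-\langle x^J\rangle_{\mu_2}\right|\le n_J\,M(J,p)^{n_J-1}\left(\frac{|I|}{1-\frac{|I|}{N}}\right)^{1/p}w_p(\mu_1,\mu_2;N), \] where $M(J,p)=1$ if $n_J=1$, and otherwise, with $q=\frac{p}{p-1}$, \[ M(J,p)=\max_{i\in I}\left(\langle|x_i|^{q(n_J-1)}\rangle_{\mu_1}^{\frac{1}{q(n_J-1)}},\ \langle|x_i|^{q(n_J-1)}\rangle_{\mu_2}^{\frac{1}{q(n_J-1)}}\right)<\infty. \]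
   Context: $[N]=\{1,\dots,N\}$. A probability measure $\mu$ on $\mathbb{R}^N$ is permutation invariant if for every integrable $f$ and every permutation $\pi$ of $[N]$, $f\circ Q_\pi$ is integrable and $\langle f\circ Q_\pi\rangle_\mu=\langle f\rangle_\mu$, where $(Q_\pi x)_j=x_{\pi^{-1}(j)}$. The specific $p$-norm fluctuation distance is $w_p(\mu_1,\mu_2;N)=\left(\inf_\gamma\int\gamma(dx,dy)\frac1N\sum_{i=1}^N|x_i-y_i|^p\right)^{1/p}$, the infimum over all couplings $\gamma$ of $\mu_1$ and $\mu_2$. *)

(* Defs.v *)
From HB Require Import structures.
From mathcomp Require Import all_boot all_order all_algebra all_fingroup.
From mathcomp Require Import all_classical all_reals all_analysis.
Set Implicit Arguments. Unset Strict Implicit. Unset Printing Implicit Defensive.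
Import Order.TTheory GRing.Theory Num.Theory.
Local Open Scope ring_scope.
Local Open Scope classical_set_scope.

(* R^N is modelled as N.-tuple R with the product (= Borel) sigma-algebra. *)
Notation RN R N := (N.-tuple R) (only parsing).

Definition Qperm (R : realType) (N : nat) (pi : {perm 'I_N}) (x : N.-tuple R)
  : N.-tuple R := [tuple tnth x ((pi^-1)%g j) | j < N].

Definition perm_invariant (R : realType) (N : nat)
  (mu : probability (N.-tuple R) R) : Prop :=
  forall (pi : {perm 'I_N}) (f : N.-tuple R -> R),
    mu.-integrable setT (EFin \o f) ->
    mu.-integrable setT (EFin \o (f \o Qperm pi)) /\
    (\int[mu]_x (f (Qperm pi x))%:E = \int[mu]_x (f x)%:E)%E.

Definition eucl (R : realType) (N : nat) (x : N.-tuple R) : R :=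
  Num.sqrt (\sum_(i < N) tnth x i ^+ 2).

Definition finite_moment (R : realType) (N : nat)
  (mu : probability (N.-tuple R) R) (p0 : R) : Prop :=
  (\int[mu]_x ((eucl x) `^ p0)%:E < +oo)%E.

Definition coupling (R : realType) (N : nat)
  (mu1 mu2 : probability (N.-tuple R) R)
  (gamma : probability (N.-tuple R * N.-tuple R)%type R) : Prop :=
  forall A : set (N.-tuple R), measurable A ->
    gamma (A `*` setT) = mu1 A /\ gamma (setT `*` A) = mu2 A.

Definition wp (R : realType) (N : nat) (p : R)
  (mu1 mu2 : probability (N.-tuple R) R) : \bar R :=
  ((ereal_inf [set (\int[gamma]_z
        ((N%:R)^-1 * \sum_(i < N) `|tnth z.1 i - tnth z.2 i| `^ p)%:E)%E
      | gamma in [set g | coupling mu1 mu2 g]]) `^ p^-1)%E.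

Definition xJ (R : realType) (N : nat) (J : seq 'I_N) (x : N.-tuple R) : R :=
  \prod_(j <- J) tnth x j.

Definition Iset (N : nat) (J : seq 'I_N) : {set 'I_N} := [set j in J].

Definition abs_moment (R : realType) (N : nat)
  (mu : probability (N.-tuple R) R) (i : 'I_N) (r : R) : \bar R :=
  (\int[mu]_x (`|tnth x i| `^ r)%:E)%E.

Definition MJp (R : realType) (N : nat) (J : seq 'I_N) (p : R)
  (mu1 mu2 : probability (N.-tuple R) R) : R :=
  if size J == 1%N then 1 else
  let q := p / (p - 1) in
  let r := q * (size J - 1)%:R in
  \big[Num.max/0]_(i in Iset J)
     Num.max (fine (abs_moment mu1 i r) `^ r^-1) (fine (abs_moment mu2 i r) `^ r^-1).

Definition Ifactor (R : realType) (N : nat) (J : seq 'I_N) (p : R) : \bar R :=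
  if (#|Iset J| < N)%N then
    (((#|Iset J|%:R / (1 - #|Iset J|%:R / N%:R)) `^ p^-1)%:E)%E
  else (+oo)%E.

(* Main.v *)
Require Import Defs.
From HB Require Import structures.
From mathcomp Require Import all_boot all_order all_algebra all_fingroup.
From mathcomp Require Import all_classical all_reals all_analysis.
From mathcomp Require Import measurable_realfun ring lra.
Import Order.TTheory GRing.Theory Num.Theory.
Local Open Scope ring_scope.
Local Open Scope classical_set_scope.

(** Fix a coupling. By permutation invariance, J may be replaced by any shift
    of J inside both moments, so the difference of the moments is at most the
    average over the N cyclic shifts of the coupling integral of
    |x^{J+k} - y^{J+k}|. Telescoping writes each such difference as a sum of n_J
    terms (x_i - y_i) times a product of n_J - 1 coordinates of x or y; Young's
    inequality separates the two factors, and AM-GM bounds the product by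
    moments of order q(n_J - 1), hence by M. Averaging over the shifts turns the
    p-th powers |x_i - y_i|^p into the transport cost, which yields the bound
    with constant 1 in place of (|I|/(1-|I|/N))^(1/p) >= 1. *)

Set Implicit Arguments. Unset Strict Implicit. Unset Printing Implicit Defensive.

(** * Differences and means of finite products *)

Lemma prodB_telescope (R : comPzRingType) (n : nat) (x y : 'I_n -> R) :
  \prod_i x i - \prod_i y i =
  \sum_l (x l - y l) * \prod_(i | i != l) (if (i < l)%N then y i else x i).
Proof.
(* [T k] takes its factors from [y] below [k] and from [x] from [k] on; consecutive values differ
   only in the factor of index [k]. *)
pose T (k : nat) := \prod_(i < n) (if (i < k)%N then y i else x i).
have -> : \prod_i x i = T 0%N by apply: eq_bigr.
have -> : \prod_i y i = T n by apply: eq_bigr => i _; rewrite ltn_ord.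
rewrite -opprB -telescope_sumr // -sumrN big_mkord; apply: eq_bigr => l _.
rewrite /T (bigD1 l)//= ltnS leqnn [in X in _ - X](bigD1 l)//= ltnn opprB mulrBl.
by congr (_ - _ * _); apply: eq_bigr => i il; rewrite ltnS leq_eqVlt (inj_eq val_inj) (negbTE il).
Qed.

(** AM-GM for the powers [a i ^+ n] with [n = #|P|]: their geometric mean is exactly the product of
    the [a i]. *)
Lemma prod_le_mean_exp (R : realType) (I : finType) (P : pred I) (a : I -> R) :
  (0 < #|P|)%N -> (forall i, 0 <= a i) ->
  \prod_(i | P i) a i <= (\sum_(i | P i) a i ^+ #|P|) / #|P|%:R.
Proof.
move=> P0 a0.
rewrite -(@ler_pXn2r _ #|P|)// ?nnegrE ?prodr_ge0 ?divr_ge0 ?sumr_ge0//; last first.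
  by move=> i _; rewrite exprn_ge0.
rewrite -prodrXl.
by apply: (@leif_AGM R I P (fun i => a i ^+ #|P|)) => i _; rewrite exprn_ge0.
Qed.

(** * Integral forms of AM-GM and Young *)

Section integral_bounds.
Context d (T : measurableType d) (R : realType) (mu : {measure set T -> \bar R}).

Lemma measurable_normr_powR (f : T -> R) (r : R) :
  measurable_fun setT f -> measurable_fun setT (fun x => `|f x| `^ r).
Proof.
move=> mf; apply: (measurableT_comp (measurable_powR r)).
exact: measurableT_comp.
Qed.

Lemma measurable_prod_cond (I : finType) (P : pred I) (z : I -> T -> R) :
  (forall i, measurable_fun setT (z i)) ->
  measurable_fun setT (fun x => \prod_(i | P i) z i x).
Proof.
move=> mz; under eq_fun do rewrite -big_filter.
by apply: measurable_prod => i _; exact: mz.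
Qed.

(** AM-GM, applied pointwise to the [|z i x| ^ q], replaces the product by an average of
    single-variable powers; each has integral at most [B], hence so does the average. *)
Lemma integral_prod_powR_le (I : finType) (P : pred I) (z : I -> T -> R)
  (q B : R) :
  (0 < #|P|)%N -> (forall i, measurable_fun setT (z i)) ->
  (forall i, P i -> \int[mu]_x (`|z i x| `^ (q * #|P|%:R))%:E <= B%:E)%E ->
  (\int[mu]_x (`|\prod_(i | P i) z i x| `^ q)%:E <= B%:E)%E.
Proof.
move=> P0 mz zB.
apply: (@le_trans _ _ (\int[mu]_x (\sum_(i | P i)
   (#|P|%:R^-1)%:E * (`|z i x| `^ (q * #|P|%:R))%:E))%E).
  apply: ge0_le_integral => //.
  - apply/measurable_EFinP; apply: (@measurable_normr_powR (fun x => \prod_(i | P i) z i x) q).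
    exact: measurable_prod_cond.
  - under eq_fun do rewrite -big_filter.
    apply: emeasurable_sum => i; apply/measurable_EFinP; apply: measurable_funM => //.
    exact: measurable_normr_powR.
  - move=> x _; under [X in (_ <= X)%E]eq_bigr do rewrite -EFinM.
    rewrite sumEFin lee_fin -mulr_sumr mulrC normr_prod.
    rewrite (_ : _ `^ q = \prod_(i | P i) `|z i x| `^ q); last first.
      (* Nonnegativity is carried through the fold because [powRM] asks for nonnegative factors. *)
      suff: 0 <= \prod_(i | P i) `|z i x| /\
        (\prod_(i | P i) `|z i x|) `^ q = \prod_(i | P i) `|z i x| `^ q by case.
      apply: (big_rec2 (fun u v => 0 <= u /\ u `^ q = v)); first by rewrite powR1.
      by move=> i u v _ [v0 <-]; rewrite mulr_ge0// powRM.
    have := @prod_le_mean_exp _ _ P (fun i => `|z i x| `^ q) P0.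
    move=> /(_ (fun i => powR_ge0 _ _)) /le_trans; apply.
    rewrite ler_pM2r ?invr_gt0 ?ltr0n//; apply: ler_sum => i _.
    by rewrite powRrM powR_mulrn ?powR_ge0.
have mz' i : measurable_fun setT (fun x => (`|z i x| `^ (q * #|P|%:R))%:E).
  by apply/measurable_EFinP; exact: measurable_normr_powR.
under eq_integral => x _ do rewrite -big_filter.
rewrite ge0_integral_sum; first last.
- by move=> i x _; rewrite mule_ge0 ?lee_fin ?invr_ge0 ?powR_ge0.
- by move=> i; exact: measurable_funeM.
- exact: measurableT.
rewrite big_filter.
apply: (@le_trans _ _ (\sum_(i | P i) (#|P|%:R^-1)%:E * B%:E)%E).
  apply: lee_sum => i Pi; rewrite ge0_integralZl//.
  by apply: lee_wpmul2l; [rewrite lee_fin invr_ge0 | exact: zB].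
under eq_bigr do rewrite -EFinM.
by rewrite sumEFin lee_fin sumr_const -[leLHS]mulr_natr mulrAC mulVf ?mul1r// pnatr_eq0 -lt0n.
Qed.

(* a and b are free normalisations: Young's inequality is applied to |f|/a and |g|/b. *)
Lemma integral_prod_le_young (f g : T -> R) (p q a b : R) :
  0 < p -> 0 < q -> p^-1 + q^-1 = 1 -> 0 < a -> 0 < b ->
  measurable_fun setT f -> measurable_fun setT g ->
  (\int[mu]_x (`|g x| `^ q)%:E <= (b `^ q)%:E)%E ->
  (\int[mu]_x `|f x * g x|%:E <=
   (a * b)%:E * ((p^-1 / a `^ p)%:E * \int[mu]_x (`|f x| `^ p)%:E + q^-1%:E))%E.
Proof.
move=> p0 q0 pq a0 b0 mf mg gb.
have ap0 : 0 < a `^ p by rewrite powR_gt0.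
have bq0 : 0 < b `^ q by rewrite powR_gt0.
have mf' : measurable_fun setT (fun x => (`|f x| `^ p)%:E).
  by apply/measurable_EFinP; exact: measurable_normr_powR.
have mg' : measurable_fun setT (fun x => (`|g x| `^ q)%:E).
  by apply/measurable_EFinP; exact: measurable_normr_powR.
apply: (@le_trans _ _ (\int[mu]_x ((a * b)%:E *
   ((p^-1 / a `^ p)%:E * (`|f x| `^ p)%:E + (q^-1 / b `^ q)%:E * (`|g x| `^ q)%:E)))%E).
  apply: ge0_le_integral => //.
  - apply/measurable_EFinP; apply: measurableT_comp => //.
    exact: measurable_funM.
  - by apply: measurable_funeM; apply: emeasurable_funD; exact: measurable_funeM.
  - move=> x _; rewrite -!EFinM -?EFinD -?EFinM lee_fin normrM.
    have /(@conjugate_powR _ _ (`|g x| / b) p q) := divr_ge0 (normr_ge0 (f x)) (ltW a0).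
    move=> /(_ (divr_ge0 (normr_ge0 _) (ltW b0)) p0 q0 pq).
    rewrite !powRM ?invr_ge0 ?(ltW a0) ?(ltW b0)//.
    (* Writing the inverses as powers with exponent -1 lets [powRAC] turn [(a^-1) ^ p] into
       [(a ^ p)^-1], and likewise for [b] and [q]. *)
    rewrite -(powR_inv1 (ltW a0)) -(powR_inv1 (ltW b0)) ![(_ `^ (-1)) `^ _]powRAC.
    rewrite !powR_inv1 ?powR_ge0 ?(ltW a0) ?(ltW b0)//.
    move=> h; have ab0 : 0 < a * b by rewrite mulr_gt0.
    rewrite -ler_pdivrMl// (le_trans (le_trans _ h))//; last by lra.
    by rewrite invfM; lra.
rewrite ge0_integralZl//; last 3 first.
- by apply: emeasurable_funD; exact: measurable_funeM.
- by move=> x _; rewrite -!EFinM -EFinD lee_fin addr_ge0 ?mulr_ge0 ?invr_ge0 ?powR_ge0 ?ltW.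
- by rewrite lee_fin mulr_ge0 ?ltW.
apply: lee_wpmul2l; first by rewrite lee_fin mulr_ge0 ?ltW.
have h0 r s (t : R) : 0 < r -> (0 <= (r^-1 / s `^ t)%:E)%E.
  by move=> r0; rewrite lee_fin mulr_ge0 ?invr_ge0 ?powR_ge0 ?ltW.
have k0 (h : T -> R) (t : R) x : (0 <= (`|h x| `^ t)%:E)%E by rewrite lee_fin powR_ge0.
rewrite ge0_integralD//; last 4 first.
- by move=> x _; rewrite mule_ge0 ?h0.
- exact: measurable_funeM.
- by move=> x _; rewrite mule_ge0 ?h0.
- exact: measurable_funeM.
rewrite !ge0_integralZl ?h0// leeD2l//.
apply: (le_trans (lee_wpmul2l (h0 _ _ _ _) gb)) => //.
by rewrite -EFinM mulfVK ?gt_eqF.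
Qed.

End integral_bounds.

(** * Integrals against the marginals of a coupling *)

Section coupling_marginals.
Context (R : realType) (N : nat) (mu1 mu2 : probability (N.-tuple R) R).
Context (gamma : probability (N.-tuple R * N.-tuple R)%type R).
Hypothesis gammaP : coupling mu1 mu2 gamma.

Lemma coupling_fst (A : set (N.-tuple R)) :
  measurable A -> pushforward gamma fst A = mu1 A.
Proof.
move=> /gammaP[<- _]; rewrite /pushforward; congr (gamma _).
by apply/seteqP; split => -[x y] //= [].
Qed.

Lemma coupling_snd (A : set (N.-tuple R)) :
  measurable A -> pushforward gamma snd A = mu2 A.
Proof.
move=> /gammaP[_ <-]; rewrite /pushforward; congr (gamma _).
by apply/seteqP; split => -[x y] //= [].
Qed.

Lemma ge0_integral_coupling_fst (f : N.-tuple R -> \bar R) :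
  measurable_fun setT f -> (forall x, 0 <= f x)%E ->
  (\int[gamma]_z f z.1 = \int[mu1]_x f x)%E.
Proof.
move=> mf f0.
rewrite -(@eq_measure_integral _ _ _ _ _ (pushforward gamma fst)); last first.
  by move=> A mA _; exact: coupling_fst.
by rewrite ge0_integral_pushforward.
Qed.

Lemma ge0_integral_coupling_snd (f : N.-tuple R -> \bar R) :
  measurable_fun setT f -> (forall x, 0 <= f x)%E ->
  (\int[gamma]_z f z.2 = \int[mu2]_x f x)%E.
Proof.
move=> mf f0.
rewrite -(@eq_measure_integral _ _ _ _ _ (pushforward gamma snd)); last first.
  by move=> A mA _; exact: coupling_snd.
by rewrite ge0_integral_pushforward.
Qed.

Lemma integrable_coupling_fst (f : N.-tuple R -> \bar R) :
  mu1.-integrable setT f -> gamma.-integrable setT (f \o fst).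
Proof.
move=> /integrableP[mf foo]; apply/integrableP; split.
  exact: measurableT_comp.
rewrite (@ge0_integral_coupling_fst (fun x => `|f x|%E))//.
exact: measurableT_comp.
Qed.

Lemma integrable_coupling_snd (f : N.-tuple R -> \bar R) :
  mu2.-integrable setT f -> gamma.-integrable setT (f \o snd).
Proof.
move=> /integrableP[mf foo]; apply/integrableP; split.
  exact: measurableT_comp.
rewrite (@ge0_integral_coupling_snd (fun x => `|f x|%E))//.
exact: measurableT_comp.
Qed.

Lemma integral_coupling_fst (f : N.-tuple R -> \bar R) :
  mu1.-integrable setT f -> (\int[gamma]_z f z.1 = \int[mu1]_x f x)%E.
Proof.
move=> fi; have [mf _] := integrableP _ _ _ fi.
rewrite -(@eq_measure_integral _ _ _ _ _ (pushforward gamma fst)); last first.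
  by move=> A mA _; exact: coupling_fst.
by rewrite integral_pushforward//; exact: integrable_coupling_fst.
Qed.

Lemma integral_coupling_snd (f : N.-tuple R -> \bar R) :
  mu2.-integrable setT f -> (\int[gamma]_z f z.2 = \int[mu2]_x f x)%E.
Proof.
move=> fi; have [mf _] := integrableP _ _ _ fi.
rewrite -(@eq_measure_integral _ _ _ _ _ (pushforward gamma snd)); last first.
  by move=> A mA _; exact: coupling_snd.
by rewrite integral_pushforward//; exact: integrable_coupling_snd.
Qed.

(** Both expectations become integrals against [gamma]; integrability lets them merge into one
    integral, and the absolute value moves inside. *)
Lemma Rintegral_coupling_le (f : N.-tuple R -> R) :
  mu1.-integrable setT (EFin \o f) -> mu2.-integrable setT (EFin \o f) ->
  (`|Rintegral mu1 setT f - Rintegral mu2 setT f|%:E <=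
   \int[gamma]_z `|f z.1 - f z.2|%:E)%E.
Proof.
move=> f1 f2.
have g1 := integrable_coupling_fst f1; have g2 := integrable_coupling_snd f2.
rewrite /Rintegral -(integral_coupling_fst f1) -(integral_coupling_snd f2).
rewrite -fineB ?integrable_fin_num// -integralB_EFin//.
have gB : gamma.-integrable setT (fun z => (f z.1 - f z.2)%:E).
  exact: integrableB g1 g2.
rewrite -fine_abse ?integrable_fin_num// fineK ?abse_fin_num ?integrable_fin_num//.
by apply: le_abse_integral => //; case/integrableP: gB.
Qed.

End coupling_marginals.

(** * Permutation invariance and finiteness of moments *)

Section permutation_invariance.
Context (R : realType) (N : nat).
Implicit Types (mu : probability (N.-tuple R) R) (J : seq 'I_N).

Lemma measurable_abs_tnth_powR (i : 'I_N) (r : R) :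
  measurable_fun setT (fun x : N.-tuple R => (`|tnth x i| `^ r)%:E).
Proof.
by apply/measurable_EFinP; apply: measurable_normr_powR; exact: measurable_tnth.
Qed.

Lemma measurable_xJ J : measurable_fun setT (xJ J : N.-tuple R -> R).
Proof. by apply: measurable_prod => i _; exact: measurable_tnth. Qed.

Lemma xJ_Qperm (pi : {perm 'I_N}) J (x : N.-tuple R) :
  xJ (map pi J) (Qperm pi x) = xJ J x.
Proof.
by rewrite /xJ big_map; apply: eq_bigr => j _; rewrite tnth_mktuple permK.
Qed.

(** Invariance is tested on the permuted monomial, since composing it with [Qperm pi] gives back
    [xJ J]. *)
Lemma Rintegral_xJ_perm mu (pi : {perm 'I_N}) J :
  perm_invariant mu -> mu.-integrable setT (EFin \o xJ (map pi J)) ->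
  Rintegral mu setT (xJ J) = Rintegral mu setT (xJ (map pi J)).
Proof.
move=> inv /(inv pi)[_ E]; rewrite /Rintegral -E; congr fine.
by apply: eq_integral => x _; rewrite xJ_Qperm.
Qed.

(** Swapping [i] and [j] turns one integrand into the other. Shifts can move [J] out of [I], whereas
    [MJp] only sees moments with index in [I]; this bridges the gap. *)
Lemma abs_moment_perm mu (i j : 'I_N) (r : R) :
  perm_invariant mu -> (abs_moment mu i r < +oo)%E ->
  abs_moment mu j r = abs_moment mu i r.
Proof.
move=> inv foo.
have /(inv (tperm i j))[_ E] :
    mu.-integrable setT (EFin \o (fun x => `|tnth x i| `^ r)).
  apply/integrableP; split; first exact: measurable_abs_tnth_powR.
  by under eq_integral do rewrite /= ger0_norm ?powR_ge0//.
transitivity (\int[mu]_x (`|tnth (Qperm (tperm i j) x) i| `^ r)%:E)%E => //.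
by apply: eq_integral => x _; rewrite tnth_mktuple tpermV tpermL.
Qed.

Lemma abs_tnth_le_eucl (x : N.-tuple R) i : `|tnth x i| <= eucl x.
Proof.
rewrite -sqrtr_sqr ler_wsqrtr// (bigD1 i)//= lerDl sumr_ge0// => j _.
exact: sqr_ge0.
Qed.

Lemma eucl_ge0 (x : N.-tuple R) : 0 <= eucl x.
Proof. exact: sqrtr_ge0. Qed.

Lemma measurable_eucl : measurable_fun setT (@eucl R N).
Proof.
rewrite (_ : @eucl R N = fun x => (\sum_(i < N) tnth x i ^+ 2) `^ 2^-1).
  apply: (measurableT_comp (measurable_powR _)).
  by apply: measurable_sum => i; apply: measurable_funX; exact: measurable_tnth.
by apply/funext => x; rewrite powR12_sqrt// sumr_ge0// => j _; exact: sqr_ge0.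
Qed.

(** The term 1 covers [a <= 1] and the power covers [a > 1], so [1 + eucl x ^ p0] dominates all
    moments of order at most [p0]. *)
Lemma powR_le_addr1 (a r s : R) : 0 <= a -> 0 <= r <= s -> a `^ r <= 1 + a `^ s.
Proof.
move=> a0 /andP[r0 rs]; have [a1|/ltW a1] := leP a 1.
  by rewrite (le_trans (ge0_ler_powR r0 _ _ a1)) ?nnegrE// powR1 lerDl powR_ge0.
by rewrite (le_trans (ler_powR a1 rs))// lerDr.
Qed.

Lemma integral_1D_eucl_lty mu (p0 : R) : finite_moment mu p0 ->
  (\int[mu]_x (1 + eucl x `^ p0)%:E < +oo)%E.
Proof.
move=> foo; under eq_integral do rewrite EFinD.
rewrite ge0_integralD//.
- apply: lte_add_pinfty => //; rewrite integral_cst// mul1e.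
  by apply: le_lt_trans (ltry 1); exact: probability_le1.
- by move=> x _; rewrite lee_fin powR_ge0.
- apply/measurable_EFinP; apply: (measurableT_comp (measurable_powR _)).
  exact: measurable_eucl.
Qed.

Lemma measurable_1D_eucl (p0 : R) :
  measurable_fun setT (fun x : N.-tuple R => (1 + eucl x `^ p0)%:E).
Proof.
apply/measurable_EFinP; apply: measurable_funD => //.
by apply: (measurableT_comp (measurable_powR _)); exact: measurable_eucl.
Qed.

Lemma abs_moment_lty mu (p0 r : R) i : finite_moment mu p0 ->
  0 <= r <= p0 -> (abs_moment mu i r < +oo)%E.
Proof.
move=> foo rp; apply: le_lt_trans (integral_1D_eucl_lty foo).
apply: ge0_le_integral => //.
- exact: measurable_abs_tnth_powR.
- exact: measurable_1D_eucl.
- move=> x _; rewrite lee_fin (le_trans _ (powR_le_addr1 (eucl_ge0 x) rp))//.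
  by case/andP: rp => r0 _; apply: ge0_ler_powR; rewrite ?nnegrE ?eucl_ge0 ?abs_tnth_le_eucl.
Qed.

(** Each coordinate is at most [eucl x] in absolute value, so the monomial is at most
    [eucl x ^ size J]. *)
Lemma integrable_xJ mu (p0 : R) J : finite_moment mu p0 ->
  (size J)%:R <= p0 -> mu.-integrable setT (EFin \o xJ J).
Proof.
move=> foo Jp; apply/integrableP; split.
  by apply/measurable_EFinP; exact: measurable_xJ.
apply: le_lt_trans (integral_1D_eucl_lty foo).
apply: ge0_le_integral => //.
- by apply: measurableT_comp => //; apply/measurable_EFinP; exact: measurable_xJ.
- exact: measurable_1D_eucl.
- have Jp' : 0 <= ((size J)%:R : R) <= p0 by rewrite ler0n.
  move=> x _; rewrite lee_fin (le_trans _ (powR_le_addr1 (eucl_ge0 x) Jp'))//.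
  rewrite powR_mulrn ?eucl_ge0// normr_prod /xJ big_tnth -[X in _ ^+ X]card_ord -prodr_const.
  by apply: ler_prod => i _; rewrite normr_ge0 abs_tnth_le_eucl.
Qed.

End permutation_invariance.

(** * Telescoping and Young for a single monomial under a coupling *)

Section coupling_bound.
Context (R : realType) (N : nat) (mu1 mu2 : probability (N.-tuple R) R).
Context (gamma : probability (N.-tuple R * N.-tuple R)%type R).
Hypothesis gammaP : coupling mu1 mu2 gamma.
Variables p q : R.
Hypotheses (p0 : 0 < p) (q0 : 0 < q) (pq : p^-1 + q^-1 = 1).

Lemma measurable_tnth_fst (i : 'I_N) :
  measurable_fun setT (fun z : N.-tuple R * N.-tuple R => tnth z.1 i).
Proof. by apply: (measurableT_comp (measurable_tnth i)). Qed.

Lemma measurable_tnth_snd (i : 'I_N) :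
  measurable_fun setT (fun z : N.-tuple R * N.-tuple R => tnth z.2 i).
Proof. by apply: (measurableT_comp (measurable_tnth i)). Qed.

Lemma measurable_tnth_sub (i : 'I_N) :
  measurable_fun setT (fun z : N.-tuple R * N.-tuple R => tnth z.1 i - tnth z.2 i).
Proof.
by apply: measurable_funB; [exact: measurable_tnth_fst|exact: measurable_tnth_snd].
Qed.

Lemma integral_xJ_sub_le (K : seq 'I_N) (a b : R) : 0 < a -> 0 < b ->
  (size K = 1%N -> 1 <= b) ->
  ((1 < size K)%N -> forall j,
     (abs_moment mu1 j (q * (size K).-1%:R) <= (b `^ q)%:E)%E /\
     (abs_moment mu2 j (q * (size K).-1%:R) <= (b `^ q)%:E)%E) ->
  (\int[gamma]_z `|xJ K z.1 - xJ K z.2|%:E <=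
   \sum_(j <- K) (a * b)%:E * ((p^-1 / a `^ p)%:E *
     \int[gamma]_z (`|tnth z.1 j - tnth z.2 j| `^ p)%:E + q^-1%:E))%E.
Proof.
move=> a0 b0 b1 Kb; rewrite [leRHS]big_tnth.
pose k := tnth (in_tuple K).
pose y (l i : 'I_(size K)) (z : N.-tuple R * N.-tuple R) :=
  if (i < l)%N then tnth z.2 (k i) else tnth z.1 (k i).
pose f (l : 'I_(size K)) (z : N.-tuple R * N.-tuple R) :=
  (tnth z.1 (k l) - tnth z.2 (k l)) * \prod_(i | i != l) y l i z.
have my l i : measurable_fun setT (y l i).
  rewrite /y; case: (i < l)%N.
    exact: measurable_tnth_snd.
  exact: measurable_tnth_fst.
have mprod l : measurable_fun setT (fun z => \prod_(i | i != l) y l i z).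
  exact: measurable_prod_cond.
have mf l : measurable_fun setT (fun z => `|f l z|%:E).
  apply/measurable_EFinP; apply: measurableT_comp => //.
  by apply: measurable_funM => //; exact: measurable_tnth_sub.
have xJB z : xJ K z.1 - xJ K z.2 = \sum_l f l z.
  rewrite /xJ (big_tnth _ _ K) [X in _ - X](big_tnth _ _ K).
  exact: (prodB_telescope (fun i => tnth z.1 (k i)) (fun i => tnth z.2 (k i))).
have mxJ K' : measurable_fun setT (fun z : N.-tuple R * N.-tuple R => xJ K' z.1 - xJ K' z.2).
  by apply: measurable_funB; apply: (measurableT_comp (measurable_xJ K')).
apply: (@le_trans _ _ (\int[gamma]_z (\sum_(l < size K) `|f l z|%:E))%E).
  apply: ge0_le_integral => //.
  - by apply/measurable_EFinP; apply: measurableT_comp.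
  - exact: emeasurable_sum.
  - move=> z _; rewrite sumEFin lee_fin xJB.
    exact: ler_norm_sum.
rewrite ge0_integral_sum//; apply: lee_sum => l _.
apply: integral_prod_le_young => //; first exact: measurable_tnth_sub.
(* For a single factor the remaining product is empty, hence 1, and [1 <= b] takes the place of the
   moment bounds. *)
have [K1|K1] := leqP (size K) 1.
  have KE : size K = 1%N.
    by apply/eqP; rewrite eqn_leq K1/= (leq_ltn_trans _ (ltn_ord l)).
  have h z : \prod_(i | i != l) y l i z = 1.
    have o0 (o : 'I_(size K)) : nat_of_ord o = 0%N.
      by have := ltn_ord o; rewrite [X in (_ < X)%N]KE ltnS leqn0 => /eqP.
    rewrite big_pred0// => i; rewrite (_ : i = l) ?eqxx//.
    by apply: val_inj; rewrite /= !o0.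
  under eq_integral do rewrite h normr1 powR1.
  rewrite integral_cst// mul1e (le_trans (probability_le1 _ _))// lee_fin.
  by rewrite -(powRr0 b); apply: ler_powR; [exact: b1 | exact: ltW].
have cK : #|(fun i => i != l)| = (size K).-1 by rewrite cardC1 card_ord.
apply: integral_prod_powR_le => //; rewrite cK; first by case: (size K) K1 => [|[]].
move=> i _; have [h1 h2] := Kb K1 (k i).
(* Each factor depends on only one of [z.1] and [z.2], so its moment is that of a marginal. *)
rewrite /y; case: (i < l)%N.
- rewrite (ge0_integral_coupling_snd gammaP (f := fun x => (`|tnth x (k i)| `^ (q * (size K).-1%:R))%:E))//.
  exact: measurable_abs_tnth_powR.
- rewrite (ge0_integral_coupling_fst gammaP (f := fun x => (`|tnth x (k i)| `^ (q * (size K).-1%:R))%:E))//.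
  exact: measurable_abs_tnth_powR.
Qed.

End coupling_bound.

(** * Vanishing moments, averaging over shifts, and the size of [Ifactor] *)

(** A vanishing moment forces the coordinate [i] to be 0 almost everywhere, which kills every
    monomial containing it. *)
Lemma Rintegral_xJ_eq0 (R : realType) (N : nat) (mu : probability (N.-tuple R) R)
    (J : seq 'I_N) (i : 'I_N) (r : R) :
  i \in J -> abs_moment mu i r = 0%E -> Rintegral mu setT (xJ J) = 0.
Proof.
move=> iJ mi0; rewrite /Rintegral.
have ae0 : ae_eq mu setT (fun x => (`|tnth x i| `^ r)%:E) (cst 0%E).
  apply/(ae_eq_integral_abs mu measurableT (measurable_abs_tnth_powR i r)).
  by rewrite -mi0; apply: eq_integral => x _; rewrite gee0_abs// lee_fin powR_ge0.
rewrite (ae_eq_integral (cst 0%E)) ?integral0//.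
  by apply/measurable_EFinP; exact: measurable_xJ.
apply: filterS ae0 => x /= /(_ I)[] /powR_eq0_eq0/normr0_eq0 xi _.
by rewrite /xJ (big_rem i)//= xi mul0r.
Qed.

Lemma xJ_average_le (R : realType) (N : nat) (mu1 mu2 : probability (N.-tuple R) R)
    (gamma : probability (N.-tuple R * N.-tuple R)%type R) (J : seq 'I_N)
    (p q a b L : R) :
  (0 < N)%N -> coupling mu1 mu2 gamma ->
  0 < p -> 0 < q -> p^-1 + q^-1 = 1 -> 0 < a -> 0 < b ->
  (size J = 1%N -> 1 <= b) ->
  ((1 < size J)%N -> forall j,
     (abs_moment mu1 j (q * (size J).-1%:R) <= (b `^ q)%:E)%E /\
     (abs_moment mu2 j (q * (size J).-1%:R) <= (b `^ q)%:E)%E) ->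
  (forall pi : {perm 'I_N},
     L%:E <= \int[gamma]_z `|xJ (map pi J) z.1 - xJ (map pi J) z.2|%:E)%E ->
  (\int[gamma]_z (N%:R^-1 * \sum_(i < N) `|tnth z.1 i - tnth z.2 i| `^ p)%:E
     <= (a `^ p)%:E)%E ->
  L <= (size J)%:R * (a * b).
Proof.
(* Exposing the successor gives the indices the additive structure of the cyclic group. *)
move: mu1 mu2 gamma J; case: N => [|n] mu1 mu2 gamma J //.
move=> _ gammaP p0 q0 pq a0 b0 b1 Jb JL cost.
pose D i := (\int[gamma]_z (`|tnth z.1 i - tnth z.2 i| `^ p)%:E)%E.
have mD i : measurable_fun setT
    (fun z : n.+1.-tuple R * n.+1.-tuple R => (`|tnth z.1 i - tnth z.2 i| `^ p)%:E).
  apply/measurable_EFinP; apply: measurable_normr_powR; exact: measurable_tnth_sub.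
have D0 i : (0 <= D i)%E by apply: integral_ge0 => z _; rewrite lee_fin powR_ge0.
have ap0 : 0 < a `^ p by rewrite powR_gt0.
have {}cost : (\sum_i D i <= (n.+1%:R * a `^ p)%:E)%E.
  move: cost; under eq_integral do rewrite EFinM -sumEFin.
  rewrite ge0_integralZl//; last 2 first.
  - exact: emeasurable_sum.
  - by move=> z _; apply: sume_ge0 => i _; rewrite lee_fin powR_ge0.
  rewrite ge0_integral_sum// => cost.
  rewrite EFinM -lee_pdivrMl ?ltr0n//.
have Dfin i : D i \is a fin_num.
  rewrite ge0_fin_numE//; apply: le_lt_trans (ltry (n.+1%:R * a `^ p)).
  by apply: le_trans cost; rewrite (bigD1 i)//= leeDl// sume_ge0.
(* The coordinate costs are finite, so the averaging can be done in [R]. *)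
pose e i := fine (D i).
have {}cost : \sum_i e i <= n.+1%:R * a `^ p.
  by rewrite -lee_fin -sumEFin; under eq_bigr do rewrite fineK//.
have shiftL k : L <= \sum_(j <- J) a * b * (p^-1 / a `^ p * e (j + k) + q^-1).
  pose s : {perm 'I_n.+1} := perm (@addIr _ k).
  have sJ : size (map s J) = size J by rewrite size_map.
  rewrite -lee_fin (le_trans (JL s))//.
  apply: (le_trans (@integral_xJ_sub_le _ _ _ _ _ gammaP _ _ p0 q0 pq _ a b a0 b0 _ _)); rewrite ?sJ//.
  rewrite big_map -sumEFin; apply: lee_sum => j _.
  by rewrite permE /= !EFinM EFinD EFinM fineK.
rewrite -(ler_pM2l (ltr0Sn R n)).
apply: (@le_trans _ _ (\sum_(k < n.+1) \sum_(j <- J) a * b * (p^-1 / a `^ p * e (j + k) + q^-1))).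
  rewrite mulr_natl -[X in _ *+ X]card_ord -sumr_const.
  by apply: ler_sum => k _; exact: shiftL.
rewrite exchange_big /=.
apply: (@le_trans _ _ (\sum_(j <- J) n.+1%:R * (a * b))); last first.
  by rewrite big_const_seq count_predT iter_addr_0 -mulr_natl; lra.
apply: ler_sum => j _; rewrite -mulr_sumr big_split/= sumr_const card_ord -mulr_sumr.
(* For fixed [j] the shifts run through every coordinate once, so each [j] in [J] collects the whole
   transport cost. *)
have -> : \sum_(k < n.+1) e (j + k) = \sum_k e k.
  by rewrite [RHS](reindex_inj (@addrI _ j)).
rewrite [leRHS]mulrC ler_pM2l ?mulr_gt0//.
(* The two Young terms are matched separately: the cost bound gives the share [p^-1], and the
   constant term is the share [q^-1]. *)
have -> : n.+1%:R = n.+1%:R * p^-1 + n.+1%:R * q^-1 :> R by rewrite -mulrDr pq mulr1.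
apply: lerD; last by rewrite mulr_natl.
by rewrite -mulrA [leRHS]mulrC ler_pM2l ?invr_gt0// mulrC ler_pdivrMr.
Qed.

(** For nonempty [J] the numerator is at least 1 and the denominator lies in (0,1]. This lets a
    bound with constant 1 imply the stated one. *)
Lemma Ifactor_ge1 (R : realType) (N : nat) (J : seq 'I_N) (p : R) :
  0 < p -> (0 < size J)%N -> (1 <= Ifactor J p)%E.
Proof.
move=> p0 J0; rewrite /Ifactor; case: ifP => [IN|_]; last exact: leey.
have I0 : (0 < #|Iset J|)%N.
  case: J J0 {IN} => //= j J _; apply/card_gt0P; exists j.
  by rewrite inE mem_head.
have N0 : 0 < N%:R :> R by rewrite ltr0n (leq_trans _ IN).
have d0 : 0 < 1 - #|Iset J|%:R / N%:R :> R.
  by rewrite subr_gt0 ltr_pdivrMr// mul1r ltr_nat.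
have pV : 0 <= p^-1 by rewrite invr_ge0 ltW.
rewrite lee_fin [leLHS](_ : 1 = 1 `^ p^-1 :> R); last by rewrite powR1.
apply: ge0_ler_powR; rewrite ?nnegrE//; first by rewrite divr_ge0// ltW.
rewrite ler_pdivlMr// mul1r (@le_trans _ _ 1)// ?ler1n//.
Qed.

(** * Choice of normalisations and passage to the infimum over couplings *)

Unset Implicit Arguments. Set Strict Implicit.

Theorem theorem2p4 (R : realType) (p p0 : R) (N : nat)
  (mu1 mu2 : probability (N.-tuple R) R) (J : seq 'I_N) :
  1 < p -> p <= p0 ->
  perm_invariant mu1 -> perm_invariant mu2 ->
  finite_moment mu1 p0 -> finite_moment mu2 p0 ->
  (size J)%:R <= p0 + 1 - p0 / p ->
  ((size J != 1%N ->
     forall i, i \in Iset J ->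
       (abs_moment mu1 i (p / (p - 1) * (size J - 1)%:R) < +oo)%E /\
       (abs_moment mu2 i (p / (p - 1) * (size J - 1)%:R) < +oo)%E) /\
   (`| Rintegral mu1 setT (xJ J) - Rintegral mu2 setT (xJ J) |%:E <=
      ((size J)%:R * MJp J p mu1 mu2 ^+ (size J - 1))%:E
        * Ifactor J p * wp p mu1 mu2)%E).
Proof.
move=> p1 pp0 inv1 inv2 fin1 fin2 Jp.
have p_gt0 : 0 < p by apply: lt_trans p1.
set q := p / (p - 1); have pB1 : 0 < p - 1 by rewrite subr_gt0.
have q_gt0 : 0 < q by rewrite divr_gt0.
have pq : p^-1 + q^-1 = 1 by rewrite /q; field; rewrite !gt_eqF.
(* Multiplied by [p], the bound on [size J] reads [p (size J - 1) <= p0 (p - 1)]. For empty [J] the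
   truncated [size J - 1] is 0. *)
have rp0 : 0 <= q * (size J - 1)%:R <= p0.
  rewrite mulr_ge0 ?(ltW q_gt0)//=.
  have [J0|J0] := posnP (size J).
    by rewrite J0 mulr0 (le_trans (ltW p_gt0)).
  rewrite natrB// /q mulrAC ler_pdivrMr// mulrBr mulr1.
  have := ler_wpM2l (ltW p_gt0) Jp.
  rewrite mulrBr mulrDr mulrCA divff ?gt_eqF//; lra.
have m1 i := abs_moment_lty i fin1 rp0.
have m2 i := abs_moment_lty i fin2 rp0.
split=> [_ i _|]; first by split.
set L := `|_ - _|; set M := MJp _ _ _ _.
have M0 : 0 <= M.
  by rewrite /M /MJp; case: ifP => // _; apply: bigmax_ge_id.
have wp0 : (0 <= wp p mu1 mu2)%E by exact: poweR_ge0.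
(* For empty [J] both moments are 1, and the right side is 0 even if [Ifactor] is infinite, as
   [0 * +oo = 0]. *)
have [Jnil|J0] := posnP (size J).
  rewrite Jnil mul0r !mul0e lee_fin /L.
  have xJ1 (mu : probability (N.-tuple R) R) : Rintegral mu setT (xJ J) = 1.
    have -> : xJ J = fun=> 1 :> R.
      by apply/funext => x; rewrite /xJ (size0nil Jnil) big_nil.
    rewrite /Rintegral integral_cst// mul1e.
    exact: (congr1 fine (probability_setT mu)).
  by rewrite !xJ1 subrr normr0.
have If1 := Ifactor_ge1 p_gt0 J0.
have If0 : (0 <= Ifactor J p)%E by apply: le_trans If1.
have K0 : 0 <= (size J)%:R * M ^+ (size J - 1) by rewrite mulr_ge0// exprn_ge0.
have [i0 i0J] : exists i, i \in J.
  by case: {+}J J0 => // j s _; exists j; rewrite mem_head.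
have mfin i (mu : probability (N.-tuple R) R) : mu = mu1 \/ mu = mu2 ->
    abs_moment mu i (q * (size J - 1)%:R) \is a fin_num.
  move=> mumu; rewrite ge0_fin_numE; first by case: mumu => ->.
  by apply: integral_ge0 => x _; rewrite lee_fin powR_ge0.
have moment_le_M i (mu : probability (N.-tuple R) R) : size J != 1%N ->
    mu = mu1 \/ mu = mu2 -> i \in J ->
    fine (abs_moment mu i (q * (size J - 1)%:R)) `^ (q * (size J - 1)%:R)^-1 <= M.
  move=> J1 mumu iJ; rewrite /M /MJp (negbTE J1).
  apply: (bigmax_sup i); first by rewrite inE.
  by rewrite le_max; case: mumu => ->; rewrite lexx ?orbT.
(* M = 0 is treated apart: the argument below divides by n_J * M ^ (n_J - 1). *)
have [/andP[J1 /eqP Meq0]|] := boolP ((size J != 1%N) && (M == 0)).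
  have xJ0 (mu : probability (N.-tuple R) R) : mu = mu1 \/ mu = mu2 ->
      Rintegral mu setT (xJ J) = 0.
    move=> mumu; apply: (Rintegral_xJ_eq0 i0J (r := q * (size J - 1)%:R)).
    have := moment_le_M i0 mu J1 mumu i0J; rewrite Meq0 => h.
    rewrite -(fineK (mfin i0 mu mumu)); congr EFin.
    by apply: (powR_eq0_eq0 (p := (q * (size J - 1)%:R)^-1)); apply: le_anti; rewrite h powR_ge0.
  by rewrite /L !xJ0; [|by right|by left]; rewrite subrr normr0 !mule_ge0.
rewrite negb_and negbK => JM.
pose b := M ^+ (size J - 1).
have b0 : 0 < b.
  rewrite /b; have [->//|J1] := eqVneq (size J) 1%N.
  by rewrite exprn_gt0// lt_neqAle eq_sym M0 andbT; case/orP: JM => //; rewrite (negbTE J1).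
suff LK : (L%:E <= ((size J)%:R * b)%:E * wp p mu1 mu2)%E.
  apply: (le_trans LK); apply: lee_wpmul2r => //.
  by rewrite -[leLHS]mule1; apply: lee_wpmul2l => //; rewrite lee_fin.
(* Here [j] is arbitrary: invariance moves it to [i0] in [J], and [M ^ (q (size J - 1))] equals
   [b ^ q]. *)
have moment_le_b j (mu : probability (N.-tuple R) R) : (1 < size J)%N ->
    mu = mu1 \/ mu = mu2 -> (abs_moment mu j (q * (size J).-1%:R) <= (b `^ q)%:E)%E.
  move=> J1 mumu; have fi := mfin i0 mu mumu.
  have inv : perm_invariant mu by case: mumu => ->.
  rewrite -subn1 (@abs_moment_perm _ _ _ i0)//; last by rewrite -ge0_fin_numE//;
    apply: integral_ge0 => x _; rewrite lee_fin powR_ge0.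
  rewrite -(fineK fi) lee_fin.
  have r_gt0 : 0 < q * (size J - 1)%:R by rewrite mulr_gt0// ltr0n subn_gt0.
  have := moment_le_M i0 mu (negbT (gtn_eqF J1)) mumu i0J.
  move=> /(ge0_ler_powR (ltW r_gt0)); rewrite !nnegrE powR_ge0 M0 => /(_ isT isT).
  rewrite -powRrM mulVf ?gt_eqF// powRr1; last first.
    by apply: fine_ge0; apply: integral_ge0 => x _; rewrite lee_fin powR_ge0.
  by rewrite /b -powR_mulrn// -powRrM mulrC.
have K_gt0 : 0 < (size J)%:R * b by rewrite mulr_gt0// ltr0n.
(* By contradiction: [wp] is then strictly below [l = L / (size J * b)], so the infimum is below
   [l ^ p] and some coupling has cost [C < l ^ p]. *)
rewrite leNgt; apply/negP; rewrite -lte_pdivlMl// -EFinM.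
set l := _ * L => wpl.
have l0 : 0 < l by rewrite -lte_fin (le_lt_trans wp0).
have pV0 : 0 <= p^-1 by rewrite invr_ge0 ltW.
have lpK : (l `^ p) `^ p^-1 = l by rewrite -powRrM mulfV ?gt_eqF// powRr1// ltW.
have : (ereal_inf [set (\int[gamma]_z
        ((N%:R)^-1 * \sum_(i < N) `|tnth z.1 i - tnth z.2 i| `^ p)%:E)%E
      | gamma in [set g | coupling mu1 mu2 g]] < (l `^ p)%:E)%E.
  rewrite ltNge; apply/negP => h.
  have /(gt0_ler_poweR pV0) := h.
  rewrite poweR_EFin lpK => /(_ _ _)/(lt_le_trans wpl); rewrite ltxx => k.
  by suff: false by []; apply: k; rewrite in_itv/= leey ?andbT ?lee_fin ?powR_ge0//
    (le_trans _ h)// lee_fin powR_ge0.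
move=> /ereal_inf_lt[_ [gamma gammaP <-]].
set C := (\int[_]_z _)%E => Cl.
have C0 : (0 <= C)%E.
  apply: integral_ge0 => z _; rewrite lee_fin mulr_ge0 ?invr_ge0//.
  by apply: sumr_ge0 => i _; exact: powR_ge0.
have Cfin : C \is a fin_num by rewrite ge0_fin_numE// (lt_trans Cl)// ltry.
(* The midpoint stays below [l ^ p] and is positive even if the cost is 0, so [c ^ p^-1] is an
   admissible normalisation [a] for Young. *)
pose c := (fine C + l `^ p) / 2.
have fC0 : 0 <= fine C by exact: fine_ge0.
have Cl' : fine C < l `^ p by rewrite -lte_fin fineK.
have c0 : 0 < c by rewrite /c; lra.
have cl : c < l `^ p by rewrite /c; lra.
have Cc : fine C <= c by rewrite /c; lra.
have aK : (c `^ p^-1) `^ p = c by rewrite -powRrM mulVf ?gt_eqF// powRr1// ltW.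
have : L <= (size J)%:R * (c `^ p^-1 * b).
  (* As [p0 / p >= 1], the size condition also makes the monomials integrable. *)
  have Jp0 : (size J)%:R <= p0.
    apply: (le_trans Jp); have : 1 <= p0 / p by rewrite ler_pdivlMr// mul1r.
    lra.
  apply: (xJ_average_le (leq_ltn_trans (leq0n i0) (ltn_ord i0)) gammaP p_gt0 q_gt0 pq) => //.
  - by rewrite powR_gt0.
  - by rewrite /b => ->.
  - by move=> J1 j; split; apply: moment_le_b => //; [left|right].
  - move=> pi.
    have ixJ (mu : probability (N.-tuple R) R) :
        finite_moment mu p0 -> mu.-integrable setT (EFin \o xJ (map pi J)).
      by move=> /integrable_xJ; apply; rewrite size_map.
    rewrite /L (Rintegral_xJ_perm inv1 (ixJ _ fin1)) (Rintegral_xJ_perm inv2 (ixJ _ fin2)).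
    exact (Rintegral_coupling_le gammaP (ixJ _ fin1) (ixJ _ fin2)).
  - by rewrite aK -/C -(fineK Cfin) lee_fin.
(* Dividing by [size J * b] gives [l <= c ^ p^-1], hence [l ^ p <= c], against the choice of [c]. *)
rewrite mulrCA mulrC -ler_pdivrMl// -/l => lc.
have : l `^ p <= c.
  by rewrite -aK; apply: ge0_ler_powR; rewrite ?nnegrE ?powR_ge0// ltW.
by rewrite leNgt cl.
Qed.
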